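(* Fix a Cartesian coordinate system in $\mathbb{R}^2$ and an integer $K\ge 2$. For Lebesgue-almost all $(\gamma_1,\dots,\gamma_K)\in\mathbb{R}^K$ the following holds: if $X$ is $\mathbb{R}^2$ with a norm $\|\cdot\|_X$ whose closed unit ball $BX$ is a symmetric convex polygon with $2K$ sides, and the slopes of its $K$ pairwise non-parallel sides are $\gamma_1,\dots,\gamma_K$, then there is a compact set $E\subset X$ of Hausdorff dimension $2$ such that the one-dimensional Lebesgue measure of $\Delta_X(E)$ is $0$.
   Context: The slope of a non-degenerate segment $I$ lying on the line $u_1x_1+u_2x_2+u_0=0$ is $-u_1/u_2$ (and $\infty$ if $u_2=0$). For $E\subset X$, $\Delta_X(E)=\{\|x-x'\|_X: x,x'\in E\}$. *)

(* Defs.v *)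
From HB Require Import structures.
From mathcomp Require Import all_boot all_order all_algebra.
From mathcomp Require Import all_classical all_reals all_analysis.
Set Implicit Arguments. Unset Strict Implicit. Unset Printing Implicit Defensive.
Import Order.TTheory GRing.Theory Num.Theory.
Local Open Scope classical_set_scope.
Local Open Scope ring_scope.

Section Defs.
Variable R : realType.

Definition is_norm2 (N : R * R -> R) : Prop :=
  (forall x, N x = 0 <-> x = (0, 0)) /\
  (forall (a : R) x, N (a * x.1, a * x.2) = `|a| * N x) /\
  (forall x y, N (x.1 + y.1, x.2 + y.2) <= N x + N y).

(** Slope of the line u1 x1 + u2 x2 + u0 = 0 : -u1/u2, and +oo (= infinity) if u2 = 0. *)
Definition slope (u1 u2 : R) : \bar R :=
  if u2 == 0 then +oo%E else (- u1 / u2)%:E.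

(** The closed unit ball of N is a symmetric convex polygon with 2K sides,
    the K pairwise non-parallel sides lying on the lines u_k . x = 1
    (their opposite sides on u_k . x = -1), and the slope of the k-th
    side is g k. *)
Definition unit_ball_polygon_with_slopes (K : nat) (N : R * R -> R)
    (g : 'I_K -> R) : Prop :=
  exists u : 'I_K -> R * R,
    (forall x : R * R, N x <= 1 <->
        forall k, `|(u k).1 * x.1 + (u k).2 * x.2| <= 1) /\
    (forall i j : 'I_K, i != j -> (u i).1 * (u j).2 != (u i).2 * (u j).1) /\
    (* each line u_k . x = 1 meets the ball in a non-degenerate segment,
       i.e. is a genuine side (by symmetry so is u_k . x = -1) *)
    (forall k, exists x y : R * R, x != y /\ N x <= 1 /\ N y <= 1 /\
        (u k).1 * x.1 + (u k).2 * x.2 = 1 /\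
        (u k).1 * y.1 + (u k).2 * y.2 = 1) /\
    (forall k, slope (u k).1 (u k).2 = (g k)%:E).

Definition dist_set (N : R * R -> R) (E : set (R * R)) : set R :=
  [set r | exists x y, E x /\ E y /\ r = N (x.1 - y.1, x.2 - y.2)].

(** Euclidean distance and diameter (diameter of the empty set is 0). *)
Definition edist (x y : R * R) : R :=
  Num.sqrt ((x.1 - y.1) ^+ 2 + (x.2 - y.2) ^+ 2).

Definition ediam (U : set (R * R)) : \bar R :=
  ereal_sup ([set 0%E] `|` [set (edist x y)%:E | x in U & y in U]).

Definition hausdorff_delta (s d : R) (E : set (R * R)) : \bar R :=
  ereal_inf [set (\sum_(i <oo) ((fine (ediam (F i))) `^ s)%:E)%E
            | F in [set F : nat -> set (R * R) |
                     E `<=` \bigcup_i F i /\ forall i, (ediam (F i) <= d%:E)%E]].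

Definition hausdorff_measure (s : R) (E : set (R * R)) : \bar R :=
  ereal_sup [set hausdorff_delta s d E | d in [set d : R | 0 < d]].

Definition hausdorff_dim (E : set (R * R)) : \bar R :=
  ereal_inf [set s%:E | s in [set s : R | 0 < s /\ hausdorff_measure s E = 0%E]].

Definition lebesgue_null (K : nat) (A : set ('I_K -> R)) : Prop :=
  forall eps : R, 0 < eps ->
    exists a b : nat -> 'I_K -> R,
      (forall n k, a n k <= b n k) /\
      A `<=` \bigcup_n [set x | forall k, a n k <= x k <= b n k] /\
      (\sum_(n <oo) (\prod_(k < K) (b n k - a n k))%:E <= eps%:E)%E.

End Defs.

(* Main.v *)
(** If the sides of the ball lie on [u_k . x = 1] and [u_k . x = -1], then
    [N z = max_k |u_k . z|], and [u_k . z] is a multiple of [z2 - g_k z1].  Let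
    [B] be a compact set such that, for some [T_j >= 1] and [eta_j -> 0], the
    numbers [T_j x] and [T_j g_k x] are within [3 eta_j] of an integer for all
    [x] in [B] and all [k].  With [E = B x B], the product [T_j (z2 - g_k z1)]
    is within [12 eta_j] of an integer for every [z] in [E - E], so the distance
    set has measure [O(eta_j)] for every [j].

    Such a [B] of dimension 1 exists for every choice of slopes: by Bohr
    recurrence the times [p] at which all [gam_i p] are within [eta] of an
    integer are [L]-dense for some [L] depending on [eta] only.  Hence in a
    Cantor construction stage [j] divides the relative size of the intervals by
    a constant [c_j] fixed in advance, whereas the number [n_j] of children (and
    with it [T_j]) is as large as we like; if it grows fast enough, the inverse
    of the parametrization of [B] by [[0, 1)] is Hoelder of every exponent less
    than 1.  Pulling a cover of [B x B] back to the unit square then bounds its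
    Hausdorff sums from below. *)

Require Import Defs.
From HB Require Import structures.
From mathcomp Require Import all_boot all_order all_algebra.
From mathcomp Require Import all_classical all_reals all_analysis.
From mathcomp Require Import ring lra.
Import Order.TTheory GRing.Theory Num.Theory.
Import numFieldNormedType.Exports.
Local Open Scope classical_set_scope.
Local Open Scope ring_scope.

(** * Almost integers and Bohr recurrence *)

Definition near_int {R : realType} (e x : R) : Prop :=
  exists z : int, `|x - z%:~R| <= e.

Lemma near_intD {R : realType} (e e' x y : R) :
  near_int e x -> near_int e' y -> near_int (e + e') (x + y).
Proof.
move=> [z xz] [w yw]; exists (z + w).
have -> : x + y - (z + w)%:~R = (x - z%:~R) + (y - w%:~R) by rewrite intrD; ring.
by apply: le_trans (ler_normD _ _) _; exact: lerD.
Qed.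

Lemma near_intN {R : realType} (e x : R) : near_int e x -> near_int e (- x).
Proof. by move=> [z xz]; exists (- z); rewrite intrN -opprD normrN. Qed.

Lemma near_int_small {R : realType} (e x : R) : `|x| <= e -> near_int e x.
Proof. by exists 0; rewrite subr0. Qed.

Lemma near_int_le {R : realType} (e e' x : R) : e <= e' -> near_int e x -> near_int e' x.
Proof. by move=> ee' [z xz]; exists z; apply: le_trans ee'. Qed.

Lemma near_int_norm {R : realType} (e x : R) : near_int e x -> near_int e `|x|.
Proof. by move=> H; case: (ger0P x) => // _; exact: near_intN. Qed.

(* Two times with the same value of [f] differ by a return time, so this makes
   return times syndetic. *)
Lemma recurrent_fin (F : finType) (f : int -> F) :
  exists m : nat, forall n : int, exists n' : int, (`|n'| <= m)%N /\ f n' = f n.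
Proof.
pose P (c : F) (n : int) := f n = c.
pose rep (c : F) : int := if pselect (exists n, P c n) is left h then projT1 (cid h) else 0.
exists (\max_(c : F) `|rep c|)%N => n.
exists (rep (f n)); split; first exact: (@leq_bigmax _ (fun c => absz (rep c))).
rewrite /rep; case: pselect => [h|[]]; last by exists n.
exact: (projT2 (cid h)).
Qed.

(** Pigeonhole: colour an integer [n] by the cells of length [1/q] containing the fractional parts
    of the [gam i * n]. Two integers of equal colour differ by a return time, and each colour in use
    has a representative of absolute value at most [m], whence [L = 2m + 1]. *)
Lemma bohr_relatively_dense (R : realType) (I : finType) (gam : I -> R) (eta : R) :
  0 < eta -> exists2 L : R, 1 <= L & forall x : R, exists p : R,
    x <= p <= x + L /\ forall i, near_int eta (gam i * p).
Proof.
move=> eta0.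
pose q := (Num.truncn eta^-1).+1.
have q0 : 0 < q%:R :> R by rewrite ltr0n.
have qeta : q%:R^-1 <= eta.
  rewrite -[leRHS]invrK lef_pV2 ?posrE ?invr_gt0//.
  by apply/ltW; rewrite /q; exact: truncnS_gt.
pose fr (x : R) := x - (Num.floor x)%:~R.
have fr0 x : 0 <= fr x < 1.
  by rewrite /fr; have /andP[a b] := floor_itv x; rewrite intrD in b; lra.
pose f (n : int) : {ffun I -> 'I_q} :=
  [ffun i => inord (Num.truncn (q%:R * fr (gam i * n%:~R)))].
have [m Hm] := recurrent_fin {ffun I -> 'I_q} f.
exists (2 * m%:R + 1) => [|x]; first by have : 0 <= m%:R :> R by []; lra.
(* Subtracting [n'], which lies between [-m] and [m], leaves an integer between [ceil x] and
   [ceil x + 2m]. *)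
pose n := Num.ceil x + m%:Z.
have [n' [n'm fn]] := Hm n.
exists ((n - n')%:~R); split.
  have n'm' : `|n'%:~R : R| <= m%:R.
    rewrite -intr_norm -[m%:R]/((m%:Z)%:~R) ler_int.
    by move: n'm; rewrite -lez_nat abszE.
  have /andP[a b] := ceil_itv x.
  have -> : (n - n')%:~R = (Num.ceil x)%:~R + m%:R - n'%:~R :> R.
    by rewrite /n intrB intrD.
  rewrite intrB in a; move: n'm'; rewrite ler_norml => /andP[c d]; apply/andP; lra.
move=> i.
move/ffunP : fn => /(_ i); rewrite !ffunE => /(congr1 val) /=.
have tr y : (Num.truncn (q%:R * fr y) < q)%N.
  have /andP[a b] := fr0 y; rewrite truncn_lt_nat; last by rewrite mulr_ge0// ltW.
  by rewrite -[ltRHS]mulr1 ltr_pM2l.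
rewrite !inordK ?tr//.
set y := gam i * _; set y' := gam i * _ => tt.
exists (Num.floor y' - Num.floor y).
have /andP[a b] := fr0 y; have /andP[a' b'] := fr0 y'.
have /truncn_itv/andP[c d] : 0 <= q%:R * fr y by nra.
have /truncn_itv/andP[c' d'] : 0 <= q%:R * fr y' by nra.
have -> : gam i * (n - n')%:~R - (Num.floor y' - Num.floor y)%:~R = fr y' - fr y.
  by rewrite /fr /y /y' !intrB; ring.
apply: le_trans qeta.
rewrite -(ler_pM2l q0) divff ?gt_eqF//.
rewrite -[in X in X * _](gtr0_norm q0) -normrM ler_norml.
rewrite -natr1 in d; rewrite -natr1 in d'.
rewrite tt in c, d.
apply/andP; nra.
Qed.

(** * A Cantor set with slowly decreasing density *)

Section CantorMap.
Context {R : realType}.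
Variables (c : nat -> R) (n : nat -> nat) (P : nat -> R -> R).

(** There are [nprod j] intervals at stage [j], of common length [level_len j]; before shifting, the
    left ends of the [n j] children of one interval are [level_gap j] apart. *)
Definition cprod j : R := \prod_(i < j) c i.
Definition nprod j : R := \prod_(i < j) (n i)%:R.
Definition level_len j : R := cprod j / nprod j.
Definition level_gap j : R := level_len j / (n j)%:R.

(** The next digit of [t] in mixed radix with bases [n], read off from the remainder [r] left by the
    earlier digits; it selects the child. *)
Definition digit j (r : R) : R := (Num.truncn ((n j)%:R * r))%:R.

(* [P] moves the left end of a child interval by at most half a gap, which leaves
   room to put it at a Bohr return time. *)
Fixpoint cantor_state (t : R) (j : nat) : R * R :=
  if j is i.+1 then
    let: (a, r) := cantor_state t i in
    (P i (a + digit i r * level_gap i), (n i)%:R * r - digit i r)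
  else (0, t).

(** Under the bounds assumed below the left ends increase, so this is the common point of the nested
    intervals selected by the digits of [t]. *)
Definition cantor_map (t : R) : R :=
  sup (range (fun j => (cantor_state t j).1)).

Hypothesis c_bounds : forall j, 0 < c j <= 4^-1.
Hypothesis n_ge2 : forall j, (2 <= n j)%N.
Hypothesis P_bounds : forall j x, x <= P j x <= x + level_gap j / 2.

Let n_gt0 j : 0 < (n j)%:R :> R.
Proof. by rewrite ltr0n (leq_trans _ (n_ge2 j)). Qed.

Let cprodS j : cprod j.+1 = cprod j * c j.
Proof. by rewrite /cprod big_ord_recr. Qed.

Let nprodS j : nprod j.+1 = nprod j * (n j)%:R.
Proof. by rewrite /nprod big_ord_recr. Qed.

Lemma cprod_gt0 j : 0 < cprod j.
Proof. by apply: prodr_gt0 => i _; have /andP[] := c_bounds i. Qed.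

Lemma cprod_decr i j : (i <= j)%N -> cprod j <= cprod i.
Proof.
elim: j => [|j IH]; first by rewrite leqn0 => /eqP ->.
rewrite leq_eqVlt => /predU1P[-> //|]; rewrite ltnS => /IH; apply: le_trans.
rewrite cprodS; have := cprod_gt0 j; have /andP[] := c_bounds j; nra.
Qed.

Lemma nprod_ge j : 2 ^+ j <= nprod j.
Proof.
elim: j => [|j IH]; first by rewrite /nprod big_ord0.
rewrite nprodS exprSr ler_pM ?exprn_ge0//.
by rewrite (ler_nat _ 2).
Qed.

Lemma nprod_gt0 j : 0 < nprod j.
Proof. by apply: lt_le_trans (nprod_ge j); rewrite exprn_gt0. Qed.

Let level_len_gt0 j : 0 < level_len j.
Proof. by rewrite divr_gt0 ?cprod_gt0 ?nprod_gt0. Qed.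

Lemma level_gap_gt0 j : 0 < level_gap j.
Proof. by rewrite divr_gt0 ?level_len_gt0. Qed.

Let level_lenE j : level_len j = (n j)%:R * level_gap j.
Proof. by rewrite /level_gap mulrC divfK// gt_eqF. Qed.

Lemma level_lenS j : level_len j.+1 = c j * level_gap j.
Proof. by rewrite /level_gap /level_len cprodS nprodS invfM; ring. Qed.

Let digit_itv j r : 0 <= r -> digit j r <= (n j)%:R * r < digit j r + 1.
Proof.
by move=> r0; rewrite /digit natr1; apply: trunc_itv; rewrite mulr_ge0.
Qed.

Let remainder_itv t j : 0 <= t < 1 -> 0 <= (cantor_state t j).2 < 1.
Proof.
move=> t01; elim: j => //= j; case: (cantor_state t j) => a r /= /andP[r0 _].
by have /andP[x y] := digit_itv j r r0; apply/andP; lra.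
Qed.

Let digit_le j r : 0 <= r < 1 -> digit j r + 1 <= (n j)%:R.
Proof.
move=> /andP[r0 r1]; rewrite /digit natr1 ler_nat truncn_lt_nat ?mulr_ge0//.
by rewrite -[ltRHS]mulr1 ltr_pM2l.
Qed.

Section point.
Variable t : R.
Hypothesis t01 : 0 <= t < 1.
Let a j := (cantor_state t j).1.
Let d j := digit j (cantor_state t j).2.

(** The shift takes at most half a gap and the child at most a quarter of one, so a quarter stays
    free before the next child. *)
Let a_step j : a j + d j * level_gap j <= a j.+1 /\
  a j.+1 + level_len j.+1 <= a j + (d j + 3 / 4) * level_gap j.
Proof.
rewrite level_lenS /a /d /=; case: (cantor_state t j) => b r /=.
have /andP[x y] := P_bounds j (b + digit j r * level_gap j); split=> //.
have := level_gap_gt0 j; have /andP[_ z] := c_bounds j; nra.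
Qed.

Let a_incr i j : (i <= j)%N -> a i <= a j.
Proof.
elim: j => [|j IH]; first by rewrite leqn0 => /eqP ->.
rewrite leq_eqVlt => /predU1P[-> //|]; rewrite ltnS => /IH /le_trans; apply.
have [+ _] := a_step j; apply: le_trans.
by rewrite lerDl mulr_ge0 ?ler0n ?ltW ?level_gap_gt0.
Qed.

Let al_decr i j : (i <= j)%N -> a j + level_len j <= a i + level_len i.
Proof.
elim: j => [|j IH]; first by rewrite leqn0 => /eqP ->.
rewrite leq_eqVlt => /predU1P[-> //|]; rewrite ltnS => /IH; apply: le_trans.
have [_ /le_trans] := a_step j; apply.
have := digit_le j _ (remainder_itv t j t01); rewrite -/(d j) => dn.
rewrite level_lenE; have := level_gap_gt0 j; nra.
Qed.

(** Left ends increase and right ends decrease, so every left end lies below every right end. *)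
Lemma cantor_map_itv j :
  (cantor_state t j).1 <= cantor_map t <= (cantor_state t j).1 + level_len j.
Proof.
apply/andP; split.
  apply: ub_le_sup; last by exists j.
  exists (a 0 + level_len 0) => _ [i _ <-].
  by apply: le_trans (al_decr 0 i (leq0n _)); rewrite lerDl ltW.
apply: ge_sup; first by exists (a 0); exists 0%N.
move=> _ [i _ <-]; rewrite -/(a i) -/(a j).
have [ij|/ltnW ji] := leqP i j.
  by apply: le_trans (a_incr _ _ ij) _; rewrite lerDl ltW.
by apply: le_trans (al_decr _ _ ji); rewrite lerDl ltW.
Qed.

Lemma cantor_map_digit j :
  a j + d j * level_gap j <= cantor_map t <= a j + (d j + 3 / 4) * level_gap j.
Proof.
have [x y] := a_step j; have /andP[z w] := cantor_map_itv j.+1.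
by apply/andP; split; [apply: le_trans z|apply: le_trans y].
Qed.

End point.

(** Both points lie in the same stage-[j] interval. If the digits differ by [D >= 1], the images are
    at least [D - 3/4] gaps apart, while [|t - t'| * cprod j] is less than [D + 1] gaps; the factor
    8 comes from [D - 3/4 >= (D + 1) / 8]. *)
Let first_digit t t' j : 0 <= t < 1 -> 0 <= t' < 1 ->
  (cantor_state t j).1 = (cantor_state t' j).1 ->
  (cantor_state t j).2 - (cantor_state t' j).2 = nprod j * (t - t') ->
  digit j (cantor_state t' j).2 < digit j (cantor_state t j).2 ->
  `|t - t'| * nprod j < 1 /\
  `|t - t'| * cprod j / 8 <= `|cantor_map t - cantor_map t'|.
Proof.
move=> t01 t'01 aa rr dd.
have /andP[x _] := cantor_map_digit t t01 j.
have /andP[_ y] := cantor_map_digit t' t'01 j.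
have rb := remainder_itv t j t01; have rb' := remainder_itv t' j t'01.
move: aa rr dd x y rb rb'; case: (cantor_state t j) (cantor_state t' j) => b r [b' r'] /=.
move=> <- rr dd x y /andP[r0 r1] /andP[r'0 r'1].
have /andP[p1 p2] := digit_itv j r r0; have /andP[q1 q2] := digit_itv j r' r'0.
have d1 : digit j r' + 1 <= digit j r.
  by move: dd; rewrite /digit natr1 ltr_nat ler_nat.
have N0 := nprod_gt0 j; have n0 := n_gt0 j; have g0 := level_gap_gt0 j.
have rr0 : r' < r by rewrite -(ltr_pM2l n0); lra.
have tt0 : 0 < t - t' by rewrite -(pmulr_rgt0 _ N0) -rr subr_gt0.
have E : (t - t') * cprod j = (n j)%:R * (r - r') * level_gap j.
  rewrite rr /level_gap /level_len; field.
  by rewrite !gt_eqF.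
rewrite gtr0_norm//; split; first by rewrite mulrC -rr; lra.
rewrite E.
apply: le_trans (ler_norm _).
nra.
Qed.

(* [j] is the first level at which the digits of [t] and [t'] differ. *)
Lemma cantor_map_separated t t' : 0 <= t < 1 -> 0 <= t' < 1 -> t != t' ->
  exists j, `|t - t'| * nprod j < 1 /\
    `|t - t'| * cprod j / 8 <= `|cantor_map t - cantor_map t'|.
Proof.
move=> t01 t'01 tt'; apply: contrapT => none.
(* Without a separating level all digits agree, and the remainders drift apart by the factor
   [nprod j]. *)
have inv j : (cantor_state t j).1 = (cantor_state t' j).1 /\
    (cantor_state t j).2 - (cantor_state t' j).2 = nprod j * (t - t').
  elim: j => [|j [aa rr]]; first by rewrite /nprod big_ord0 mul1r.
  have := first_digit t t' j t01 t'01 aa rr.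
  have := first_digit t' t j t'01 t01 (esym aa).
  rewrite -opprB rr -mulrN opprB => /(_ erefl) H1 H2.
  have dd : digit j (cantor_state t j).2 = digit j (cantor_state t' j).2.
    case: (ltgtP (digit j (cantor_state t j).2) (digit j (cantor_state t' j).2)) => //.
      by move=> /H1 H; case: none; exists j; rewrite distrC [leRHS]distrC.
    by move=> /H2 H; case: none; exists j.
  move: aa rr dd => /=; case: (cantor_state t j) (cantor_state t' j) => b r [b' r'] /=.
  move=> -> rr ->; split => //; rewrite nprodS mulrAC -rr; ring.
have u0 : 0 < `|t - t'| by rewrite normr_gt0 subr_eq0.
(* Here [nprod j >= 2 ^ j] exceeds [1 / |t - t'|], so the remainders would be more than 1 apart,
   although both lie in [[0, 1)]. *)
pose j := Num.truncn `|t - t'|^-1.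
have : `|t - t'|^-1 < nprod j.
  apply: lt_le_trans (truncnS_gt _) _; apply: le_trans (nprod_ge j).
  by rewrite -natrX ler_nat ltn_expl.
have [_ /(congr1 Num.norm)] := inv j.
rewrite normrM (gtr0_norm (nprod_gt0 j)) => E.
rewrite -(ltr_pM2r u0) mulVf ?gt_eqF// -E; apply/negP; rewrite -leNgt.
have /andP[p q] := remainder_itv t j t01; have /andP[p' q'] := remainder_itv t' j t'01.
rewrite ler_norml; apply/andP; lra.
Qed.

(** At the separating level [j], growth gives [|t - t'| <= cprod j ^ j]. For [j >= J] one extra
    power of [|t - t'|] therefore pays for the loss [cprod j ^ J]; the levels [j < J] are absorbed
    into the constant, as [cprod J <= cprod j]. *)
Lemma cantor_map_inverse_holder (J : nat) :
  (forall j, 1 <= nprod j * cprod j ^+ j) ->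
  exists2 k : R, 0 < k & forall t t' : R, 0 <= t < 1 -> 0 <= t' < 1 ->
    k * `|t - t'| ^+ J.+1 <= `|cantor_map t - cantor_map t'| ^+ J.
Proof.
move=> growth.
exists ((cprod J / 8) ^+ J) => [|t t' t01 t'01].
  by rewrite exprn_gt0// divr_gt0 ?cprod_gt0.
have [->|tt'] := eqVneq t t'.
  by rewrite !subrr normr0 expr0n mulr0 exprn_ge0.
have [j [uN vu]] := cantor_map_separated t t' t01 t'01 tt'.
have u1 : `|t - t'| <= 1.
  by move: t01 t'01 => /andP[x y] /andP[x' y']; rewrite ler_norml; apply/andP; lra.
set u := `|_| in uN vu u1 *; have u0 : 0 <= u by exact: normr_ge0.
apply: (@le_trans _ _ ((u * cprod j / 8) ^+ J)); last first.
  by apply: lerXn2r; rewrite ?nnegrE// divr_ge0 ?mulr_ge0// ltW ?cprod_gt0.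
rewrite exprS -[u * cprod j / 8]mulrA [leRHS]exprMn [leRHS]mulrC mulrA.
apply: ler_wpM2r; first exact: exprn_ge0.
have [Jj|/ltnW jJ] := leqP J j.
  rewrite !expr_div_n mulrAC ler_pM2r ?invr_gt0 ?exprn_gt0//.
  have cJ0 := cprod_gt0 J; have cj0 := cprod_gt0 j.
  have cle i : cprod i <= 1 by rewrite (le_trans (cprod_decr 0 i _))// /cprod big_ord0.
  apply: (@le_trans _ _ u).
    by rewrite -[leRHS]mul1r ler_wpM2r// exprn_ile1// ltW.
  apply: (@le_trans _ _ (cprod j ^+ j)); last by apply: ler_wiXn2l => //; rewrite ltW.
  by have := growth j; have := nprod_gt0 j; nra.
apply: (@le_trans _ _ ((cprod J / 8) ^+ J)).
  by rewrite -[leRHS]mulr1 ler_wpM2l// exprn_ge0// divr_ge0// ltW ?cprod_gt0.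
apply: lerXn2r; rewrite ?nnegrE ?divr_ge0 ?(ltW (cprod_gt0 _))//.
by rewrite ler_pM2r// cprod_decr.
Qed.

End CantorMap.

Lemma bohr_cantor_map (R : realType) (I : finType) (gam : I -> R) (eta : nat -> R) :
  (forall j, 0 < eta j <= 2^-1) ->
  exists (f : R -> R) (T : nat -> R),
    [/\ forall j, 1 <= T j,
        forall t : R, 0 <= t < 1 -> 0 <= f t <= 1,
        forall t j i, 0 <= t < 1 -> near_int (2 * eta j) (gam i * T j * f t) &
        forall J : nat, exists2 k : R, 0 < k &
          forall t t' : R, 0 <= t < 1 -> 0 <= t' < 1 ->
            k * `|t - t'| ^+ J.+1 <= `|f t - f t'| ^+ J].
Proof.
move=> eta_bounds.
have eta_gt0 j : 0 < eta j by have /andP[] := eta_bounds j.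
have /choice[L HL] : forall j, exists L : R, 1 <= L /\ forall x : R, exists p : R,
    x <= p <= x + L /\ forall i, near_int (eta j) (gam i * p).
  by move=> j; have [L L1 HL] := bohr_relatively_dense R I gam (eta j) (eta_gt0 j); exists L.
have L1 j : 1 <= L j by have [] := HL j.
have L0 j : 0 < L j by apply: lt_le_trans (L1 j).
have /choice[pick Hpick] : forall jx : nat * R, exists p : R,
    jx.2 <= p <= jx.2 + L jx.1 /\ forall i, near_int (eta jx.1) (gam i * p).
  by move=> [j x] /=; have [_] := HL j; exact.
pose M : R := 1 + \sum_i `|gam i|.
have M1 : 1 <= M by rewrite lerDl sumr_ge0.
have gamM i : `|gam i| <= M.
  by rewrite /M (bigD1 i)//= addrCA lerDl addr_ge0// sumr_ge0.
(* chosen so that [T j * M * level_len j.+1 = eta j]: moving inside a child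
   interval then costs at most another [eta j] *)
pose c j : R := eta j / (2 * L j * M).
have c_bounds j : 0 < c j <= 4^-1.
  have M0 : 0 < M by lra.
  have den : 2 <= 2 * L j * M by have := L1 j; nra.
  have den0 : 0 < 2 * L j * M by lra.
  rewrite /c divr_gt0//= ler_pdivrMr//.
  by have /andP[_ ?] := eta_bounds j; nra.
(* Large enough for the growth condition; no circularity arises, since [c] does not depend on
   [n]. *)
pose n j := maxn 2 (Num.truncn (cprod c j.+1 ^+ j.+1)^-1).+1.
have n_ge2 j : (2 <= n j)%N by rewrite leq_max.
have C0 := cprod_gt0 c c_bounds; have N0 := @nprod_gt0 R n n_ge2.
have s0 := level_gap_gt0 c n c_bounds n_ge2.
(* Scaled by [T j], half a gap has length exactly [L j], so [P j] can round [T j * x] up to a return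
   time. *)
pose T j : R := 2 * L j / level_gap c n j.
have T0 j : 0 < T j by rewrite divr_gt0// mulr_gt0.
pose P j x : R := pick (j, T j * x) / T j.
have P_bounds j x : x <= P j x <= x + level_gap c n j / 2.
  have [/= /andP[p q] _] := Hpick (j, T j * x).
  rewrite /P ler_pdivlMr// ler_pdivrMr// [x * _]mulrC p/=.
  apply: le_trans q _; rewrite [leRHS]mulrC mulrDr lerD2l /T.
  have s00 := lt0r_neq0 (s0 j).
  by rewrite [leRHS](_ : _ = L j)//; field.
have s1 j : level_gap c n j <= 1 :> R.
  have n0 : (0 < n j)%N by exact: leq_trans (n_ge2 j).
  rewrite /level_gap ler_pdivrMr ?ltr0n//. rewrite mul1r.
  apply: (@le_trans _ _ 1); last by rewrite ler1n.
  rewrite /level_len ler_pdivrMr// mul1r (@le_trans _ _ 1)//.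
    by rewrite (le_trans (cprod_decr c c_bounds 0 j _))// /cprod big_ord0.
  by apply: le_trans (nprod_ge n n_ge2 j); rewrite exprn_ege1// ler1n.
exists (cantor_map c n P), T; split.
- move=> j; rewrite /T ler_pdivlMr// mul1r; have := s1 j; have := L1 j; lra.
- move=> t t01.
  have := cantor_map_itv c n P c_bounds n_ge2 P_bounds t t01 0.
  by rewrite /= add0r /level_len /cprod /nprod !big_ord0 divr1.
- move=> t j i t01.
  have := cantor_map_itv c n P c_bounds n_ge2 P_bounds t t01 j.+1.
  set f := cantor_map _ _ _ _; set a := (cantor_state _ _ _ _ _).1.
  rewrite level_lenS => /andP[af fa].
  have Ta : near_int (eta j) (gam i * (T j * a)).
    rewrite /a /=; case: (cantor_state _ _ _ _ _) => b r /=; rewrite /P.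
    rewrite [T j * _]mulrC divfK ?gt_eqF//.
    by have [_] := Hpick (j, T j * (b + digit n j r * level_gap c n j)).
  have -> : gam i * T j * f = gam i * (T j * a) + gam i * T j * (f - a) by ring.
  rewrite mulr2n mulrDl mul1r; apply: near_intD => //; apply: near_int_small.
  rewrite normrM [`|gam i * _|]normrM (gtr0_norm (T0 j)) [`|f - a|]ger0_norm ?subr_ge0//.
  have Tc : T j * (c j * level_gap c n j) * M = eta j.
    rewrite /T /c; have s00 := lt0r_neq0 (s0 j).
    have M0 : M != 0 by rewrite gt_eqF//; lra.
    by field; rewrite s00 M0 gt_eqF.
  rewrite -Tc [leLHS](_ : _ = T j * (f - a) * `|gam i|); last by ring.
  apply: ler_pM => //; first by apply: mulr_ge0; rewrite ?subr_ge0// ltW.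
  by rewrite ler_pM2l// lerBlDl.
- move=> J; apply: (cantor_map_inverse_holder c n P c_bounds n_ge2 P_bounds J).
  case=> [|j]; first by rewrite /nprod big_ord0 expr0 mulr1.
  rewrite -ler_pdivrMr ?exprn_gt0// div1r /nprod big_ord_recr/=.
  have nj : (cprod c j.+1 ^+ j.+1)^-1 <= (n j)%:R.
    apply/ltW; apply: lt_le_trans (truncnS_gt _) _.
    by rewrite ler_nat leq_max leqnn orbT.
  apply: le_trans nj _; rewrite -[leLHS]mul1r ler_wpM2r//.
  by apply: le_trans (nprod_ge n n_ge2 j); rewrite exprn_ege1// ler1n.
Qed.

(** * Hausdorff dimension of a product *)

Section HausdorffDim.
Context {R : realType}.
Implicit Types (U E : set (R * R)) (s d : R).

Lemma edist_ge (x y : R * R) :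
  `|x.1 - y.1| <= Defs.edist x y /\ `|x.2 - y.2| <= Defs.edist x y.
Proof.
by split; rewrite -sqrtr_sqr; apply: ler_wsqrtr; rewrite ?lerDl ?lerDr sqr_ge0.
Qed.

Lemma edist_le (x y : R * R) : Defs.edist x y <= `|x.1 - y.1| + `|x.2 - y.2|.
Proof.
rewrite -[leRHS]ger0_norm ?addr_ge0// -sqrtr_sqr; apply: ler_wsqrtr.
rewrite [leRHS]sqrrD !real_normK ?num_real// addrAC lerDl.
by rewrite mulrn_wge0// mulr_ge0.
Qed.

Lemma ediam_ge0 U : (0 <= ediam U)%E.
Proof. by apply: ereal_sup_ubound; left. Qed.

Lemma ediam_ge U x y : U x -> U y -> ((Defs.edist x y)%:E <= ediam U)%E.
Proof. by move=> Ux Uy; apply: ereal_sup_ubound; right; exists x => //; exists y. Qed.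

Lemma ediam_le U d : 0 <= d -> (forall x y, U x -> U y -> Defs.edist x y <= d) ->
  (ediam U <= d%:E)%E.
Proof.
move=> d0 H; apply: ge_ereal_sup => _ [->|[x Ux [y Uy <-]]]; rewrite lee_fin//.
exact: H.
Qed.

Lemma hausdorff_delta_ge0 s d E : (0 <= hausdorff_delta s d E)%E.
Proof.
apply: le_ereal_inf_tmp => _ [F _ <-].
by apply: nneseries_ge0 => i _ _; rewrite lee_fin powR_ge0.
Qed.

Lemma le_hausdorff_measure s d E : 0 < d ->
  (hausdorff_delta s d E <= hausdorff_measure s E)%E.
Proof. by move=> d0; apply: ereal_sup_ubound; exists d. Qed.

(** Cover by [(m + 1)^2] grid cells of diameter at most [w = 2/m]: the sum is at most
    [16 * w ^ (s - 2)], which is small for large [m]. *)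
Lemma hausdorff_measure_unit_square s E : 2 < s ->
  E `<=` [set x | 0 <= x.1 <= 1 /\ 0 <= x.2 <= 1] -> hausdorff_measure s E = 0%E.
Proof.
move=> s2 E01; apply/eqP; rewrite eq_le; apply/andP; split; last first.
  exact: le_trans (hausdorff_delta_ge0 s 1 E) (le_hausdorff_measure s 1 E ltr01).
apply: ge_ereal_sup => _ [d /= d0 <-].
apply/lee_addgt0Pr => e e0; rewrite add0e.
pose b := Num.min d ((e / 16) `^ (s - 2)^-1).
have b0 : 0 < b by rewrite lt_min d0 powR_gt0// divr_gt0.
pose m := (Num.truncn (2 / b)).+1.
have m0 : 0 < m%:R :> R by rewrite ltr0n.
pose w : R := 2 / m%:R.
have w0 : 0 < w by rewrite divr_gt0.
have wb : w <= b.
  rewrite /w ler_pdivrMr// mulrC -ler_pdivrMr//.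
  by apply/ltW; exact: truncnS_gt.
have wd : w <= d by apply: le_trans wb _; rewrite ge_min lexx.
have we : w `^ (s - 2) <= e / 16.
  have s20 : 0 < s - 2 by lra.
  have wb' : w <= (e / 16) `^ (s - 2)^-1 by apply: le_trans wb _; rewrite ge_min lexx orbT.
  have := ge0_ler_powR (ltW s20) _ _ wb'; rewrite !nnegrE powR_ge0 (ltW w0) => /(_ isT isT).
  by rewrite -powRrM mulVf ?gt_eqF// powRr1// divr_ge0// ltW.
pose cell (k : nat) : set R := [set x | k%:R <= m%:R * x <= k.+1%:R].
(* Each axis needs [m + 1] cells because the coordinate 1 gets index [m]. The remaining sets are
   empty and contribute [0 ^ s = 0]. *)
pose F (i : nat) : set (R * R) :=
  if (i < m.+1 * m.+1)%N then cell (i %/ m.+1)%N `*` cell (i %% m.+1)%N else set0.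
have cellw k x y : cell k x -> cell k y -> `|x - y| <= m%:R^-1.
  rewrite /cell /= -natr1 => /andP[a1 a2] /andP[c1 c2].
  rewrite -(ler_pM2l m0) divff ?gt_eqF// -[m%:R in leLHS]gtr0_norm// -normrM mulrBr.
  by rewrite ler_norml; apply/andP; lra.
have Fw i : (ediam (F i) <= w%:E)%E.
  apply: ediam_le; first exact: ltW.
  move=> x y; rewrite /F; case: ifP => // _ [x1 x2] [y1 y2].
  apply: le_trans (edist_le _ _) _; rewrite /w mulr2n mulrDl mul1r.
  by apply: lerD; [exact: (cellw (i %/ m.+1)%N)|exact: (cellw (i %% m.+1)%N)].
have index (x : R) : 0 <= x <= 1 -> exists2 k, (k < m.+1)%N & cell k x.
  move=> /andP[x0 x1]; exists (Num.truncn (m%:R * x)).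
    by rewrite ltnS truncn_le_nat (le_lt_trans (_ : _ <= m%:R))// ?ltr_nat// ger_pMr.
  have /andP[p q] : (Num.truncn (m%:R * x))%:R <= m%:R * x < (Num.truncn (m%:R * x)).+1%:R.
    by apply: trunc_itv; rewrite mulr_ge0.
  by rewrite /cell /= p ltW.
have EF : E `<=` \bigcup_i F i.
  move=> x /E01[/index[k km kx] /index[l lm lx]].
  exists (k * m.+1 + l)%N => //; rewrite /F.
  have -> : (k * m.+1 + l < m.+1 * m.+1)%N.
    by rewrite (leq_trans (_ : _ < k.+1 * m.+1)%N)// ?leq_mul// mulSn addnC ltn_add2r.
  by rewrite divnMDl// divn_small// addn0 modnMDl modn_small.
have sum : ((\sum_(i <oo) ((fine (ediam (F i))) `^ s)%:E)%E <= e%:E)%E.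
  have Fs i : fine (ediam (F i)) `^ s <= w `^ s.
    apply: ge0_ler_powR; rewrite ?nnegrE ?(ltW w0)//; first by lra.
      exact: fine_ge0 (ediam_ge0 _).
    rewrite -lee_fin fineK// ge0_fin_numE ?ediam_ge0//.
    by apply: le_lt_trans (Fw i) _; rewrite ltry.
  rewrite (nneseries_split 0 (m.+1 * m.+1)); last by move=> k _; rewrite lee_fin powR_ge0.
  rewrite [X in (_ + X)%E]eseries0 ?adde0; last first.
    move=> i; rewrite add0n /F leqNgt => /negbTE -> _.
    have -> : ediam (set0 : set (R * R)) = 0%E.
      apply/eqP; rewrite eq_le ediam_ge0 andbT.
      by apply: ediam_le.
    by rewrite /= powR0// gt_eqF//; lra.
  apply: (@le_trans _ _ (\sum_(0 <= k < 0 + m.+1 * m.+1) (w `^ s)%:E)%E).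
    by apply: lee_sum => i _; rewrite lee_fin.
  rewrite sumEFin lee_fin add0n big_const_nat iter_addr_0 subn0.
  have -> : w `^ s = w `^ (s - 2) * w ^+ 2.
    by rewrite -powR_mulrn ?(ltW w0)// -powRD ?subrK// (gt_eqF w0) implybT.
  rewrite -[leLHS]mulr_natr -mulrA natrM.
  have -> : w ^+ 2 * (m.+1%:R * m.+1%:R) = (2 * (m.+1%:R / m%:R)) ^+ 2.
    by rewrite /w; field; rewrite gt_eqF.
  have m2 : 2 * (m.+1%:R / m%:R) <= 4 :> R.
    rewrite mulrA ler_pdivrMr// -natr1.
    have : 1 <= m%:R :> R by rewrite ler1n.
    by lra.
  have m20 : 0 <= 2 * (m.+1%:R / m%:R) :> R by rewrite mulr_ge0// divr_ge0// ltW.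
  have := powR_ge0 w (s - 2).
  move: we m2 m20; move: (w `^ (s - 2)) (2 * (m.+1%:R / m%:R)) => p q pe q4 q0 p0.
  have q16 : q ^+ 2 <= 16 by nra.
  by apply: le_trans (ler_wpM2l p0 q16) _; lra.
apply: ge_ereal_inf; exists (\sum_(i <oo) ((fine (ediam (F i))) `^ s)%:E)%E => //.
exists F => //; split=> // i; apply: le_trans (Fw i) _; by rewrite lee_fin.
Qed.

(** By the inverse Hoelder bound, a set of diameter [rho] pulls back into a square of half-side
    [w = (rho^J / k)^(1/(J+1))], of area at most [C * rho^s]. These squares cover the unit square,
    so the sum of the [rho^s] is at least [1/C]. *)
Lemma hausdorff_measure_gt0 s (f : R -> R) (E : set (R * R)) (J : nat) (k : R) :
  0 < s -> s * J.+1%:R <= 2 * J%:R -> 0 < k ->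
  (forall t t' : R, 0 <= t < 1 -> 0 <= t' < 1 ->
     k * `|t - t'| ^+ J.+1 <= `|f t - f t'| ^+ J) ->
  (forall t t' : R, 0 <= t < 1 -> 0 <= t' < 1 -> E (f t, f t')) ->
  (0 < hausdorff_measure s E)%E.
Proof.
move=> s0 sJ k0 fH fE.
pose kk := k^-1 `^ (J.+1%:R)^-1.
have kk0 : 0 < kk by rewrite powR_gt0// invr_gt0.
pose C := 4 * kk ^+ 2.
have C0 : 0 < C by rewrite mulr_gt0// exprn_gt0.
suff : (C^-1%:E <= hausdorff_delta s 1 E)%E.
  move=> H; apply: lt_le_trans (le_hausdorff_measure s 1 E ltr01).
  by apply: lt_le_trans H; rewrite lte_fin invr_gt0.
apply: le_ereal_inf_tmp => _ [F [EF F1] <-].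
pose rho i := fine (ediam (F i)).
have rhoE i : (rho i)%:E = ediam (F i).
  by rewrite /rho fineK// ge0_fin_numE ?ediam_ge0// (le_lt_trans (F1 i))// ltry.
have rho0 i : 0 <= rho i by rewrite -lee_fin rhoE ediam_ge0.
have rho1 i : rho i <= 1 by rewrite -lee_fin rhoE.
pose w i := kk * rho i `^ (J%:R / J.+1%:R).
have w0 i : 0 <= w i by rewrite mulr_ge0 ?powR_ge0// ltW.
have wJ i : w i ^+ J.+1 = k^-1 * rho i ^+ J.
  rewrite /w exprMn -!powR_mulrn ?powR_ge0// -!powRrM.
  by rewrite mulVf ?pnatr_eq0// divfK ?pnatr_eq0// powRr1// invr_ge0 ltW.
have wle i t t' : 0 <= t < 1 -> 0 <= t' < 1 -> `|f t - f t'| <= rho i -> `|t - t'| <= w i.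
  move=> t01 t'01 ft; rewrite -(@ler_pXn2r _ J.+1)// ?nnegrE//.
  rewrite wJ mulrC ler_pdivlMr// mulrC; apply: le_trans (fH _ _ t01 t'01) _.
  by apply: lerXn2r; rewrite ?nnegrE.
have w2 i : 4 * w i ^+ 2 <= C * rho i `^ s.
  rewrite /C -mulrA ler_pM2l// /w exprMn ler_pM2l ?exprn_gt0//.
  rewrite -powR_mulrn ?powR_ge0// -powRrM.
  (* A diameter 0 is treated apart because [0] to the power [0] is 1; the exponent is nonzero as
     [J != 0]. Otherwise [rho <= 1] allows the exponent [2J/(J+1)] to be lowered to [s]. *)
  have [->|r0] := eqVneq (rho i) 0.
    have J0 : J != 0%N.
      by apply: contraTneq sJ => ->; rewrite mulr0 -ltNge mulr_gt0.
    by rewrite [leLHS]powR0 ?powR_ge0// !mulf_neq0// ?invr_neq0// pnatr_eq0.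
  apply: ger_powR; first by rewrite lt_neqAle eq_sym r0 rho0 rho1.
  by rewrite mulrAC ler_pdivlMr// [_ * 2]mulrC.
pose I01 : set R := `[0, 1[%classic.
pose box (x : R * R) (e : R) : set (R * R) :=
  `[x.1 - e, x.1 + e]%classic `*` `[x.2 - e, x.2 + e]%classic.
pose mu := (@lebesgue_measure R \x @lebesgue_measure R)%E.
have mbox x e : measurable (box x e) by apply: measurableX; exact: measurable_itv.
have mubox x e : 0 <= e -> mu (box x e) = (4 * e ^+ 2)%:E.
  move=> e0.
  have itvE (y : R) : lebesgue_measure `[y - e, y + e]%classic = (2 * e)%:E.
    rewrite lebesgue_measure_itv /= lte_fin; case: ltP => [_|ye].
      by rewrite -EFinB; congr (_%:E); ring.
    by congr (_%:E); lra.
  rewrite /mu /box product_measure1E ?[X in (X * _)%E]itvE ?[X in (_ * X)%E]itvE//;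
    try exact: measurable_itv.
  by rewrite -EFinM; congr (_%:E); ring.
(* The centre is any parameter pair mapped into [F i]; if there is none, [(0, 0)] serves
   vacuously. *)
have /choice[pt Hpt] : forall i, exists x : R * R, forall t t' : R,
    0 <= t < 1 -> 0 <= t' < 1 -> F i (f t, f t') -> box x (w i) (t, t').
  move=> i; have [[[x1 x2] /= [x1P [x2P Fx]]]|none] := pselect (exists x : R * R,
    0 <= x.1 < 1 /\ 0 <= x.2 < 1 /\ F i (f x.1, f x.2)); last first.
    by exists (0, 0) => t t' t01 t'01 Ft; case: none; exists (t, t').
  exists (x1, x2) => t t' t01 t'01 Ft.
  have := ediam_ge _ _ _ Fx Ft; rewrite -rhoE lee_fin => xt.
  have [/= d1 d2] := edist_ge (f x1, f x2) (f t, f t').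
  have := wle i x1 t x1P t01 (le_trans d1 xt); have := wle i x2 t' x2P t'01 (le_trans d2 xt).
  rewrite !ler_norml => /andP[a1 a2] /andP[b1 b2].
  by rewrite /box; split; apply/andP; rewrite /= ?bnd_simp; lra.
have cover : I01 `*` I01 `<=` \bigcup_i box (pt i) (w i).
  move=> [t t'] []; rewrite /I01 /= !in_itv/= => t01 t'01.
  by have [i _ Fi] := EF _ (fE t t' t01 t'01); exists i => //; exact: Hpt.
have mI : measurable I01 by exact: measurable_itv.
have mII : measurable (I01 `*` I01 : set (measurableTypeR R * measurableTypeR R)).
  exact: measurableX.
have muII : mu (I01 `*` I01) = 1%E.
  have muI : lebesgue_measure I01 = 1%E.
    by rewrite lebesgue_measure_itv/= lte_fin ltr01 sube0.
  by rewrite /mu product_measure1E// [X in (X * _)%E]muI [X in (_ * X)%E]muI mule1.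
have H : (1 <= \sum_(i <oo) mu (box (pt i) (w i)))%E.
  rewrite -[X in (X <= _)%E]muII.
  exact: (@measure_sigma_subadditive _ _ _ mu _ (fun i => box (pt i) (w i))
    (fun i => mbox (pt i) (w i)) mII cover).
rewrite -(@lee_pmul2l _ C%:E)// ?lte_fin// -EFinM divff ?gt_eqF//.
apply: le_trans H _.
rewrite -nneseriesZl; last by move=> i _; rewrite lee_fin powR_ge0.
apply: lee_nneseries => [i _ _|i _]; first exact: measure_ge0.
by rewrite mubox// -EFinM lee_fin.
Qed.

Lemma hausdorff_dim_square (f : R -> R) (B : set R) :
  (forall J : nat, exists2 k : R, 0 < k &
     forall t t' : R, 0 <= t < 1 -> 0 <= t' < 1 ->
       k * `|t - t'| ^+ J.+1 <= `|f t - f t'| ^+ J) ->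
  (forall t : R, 0 <= t < 1 -> B (f t)) -> B `<=` `[0, 1]%classic ->
  hausdorff_dim (B `*` B) = 2%:E.
Proof.
move=> fH fB B01; apply/eqP; rewrite eq_le; apply/andP; split.
  apply/lee_addgt0Pr => e e0; apply: ereal_inf_lbound; exists (2 + e) => //.
  split; first by lra.
  apply: hausdorff_measure_unit_square; first by lra.
  by move=> [x y] [/= /B01 + /B01]; rewrite /= !in_itv.
apply: le_ereal_inf_tmp => _ [s [s0 Hs] <-]; rewrite lee_fin leNgt; apply/negP => s2.
(* The condition [s (J + 1) <= 2 J] amounts to [J >= s / (2 - s)]. *)
pose J := (Num.truncn (s / (2 - s))).+1.
have [k k0 kH] := fH J.
suff : (0 < hausdorff_measure s (B `*` B))%E by rewrite Hs ltxx.
apply: (hausdorff_measure_gt0 s f _ J k) => //; last by move=> t t' *; split => /=; exact: fB.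
have sJ : s / (2 - s) <= J%:R by apply/ltW; exact: truncnS_gt.
by rewrite ler_pdivrMr ?subr_gt0// in sJ; rewrite -natr1; lra.
Qed.

End HausdorffDim.

(** * Null sets and the distance set *)

(* [lebesgue_measure] is an outer measure on all sets, so [D] need not be
   measurable. *)
Lemma outer_null (R : realType) (D : set R) :
  (forall e : R, 0 < e -> exists V : set R,
    [/\ D `<=` V & (@lebesgue_measure R V <= e%:E)%E]) ->
  @lebesgue_measure R D = 0%E.
Proof.
move=> H; apply/eqP; rewrite eq_le measure_ge0 andbT.
apply/lee_addgt0Pr => e e0; rewrite add0e.
have [V [DV mV]] := H _ e0.
apply: le_trans mV.
exact: le_mu_ext.
Qed.

Lemma outer_null_bigcup (R : realType) (A : (set R)^nat) (D : set R) :
  D `<=` \bigcup_n A n -> (forall n, @lebesgue_measure R (A n) = 0%E) ->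
  @lebesgue_measure R D = 0%E.
Proof.
move=> DA A0; apply/eqP; rewrite eq_le measure_ge0 andbT.
apply: (@le_trans _ _ (@lebesgue_measure R (\bigcup_n A n))); first exact: le_mu_ext.
apply: (@le_trans _ _ (\sum_(n <oo) @lebesgue_measure R (A n))%E).
  exact: mu_ext_sigma_subadditive.
by rewrite eseries0// => i _ _; exact: A0.
Qed.

Lemma near_int_cover (R : realType) (w e b : R) : 0 < w -> 0 <= e < 1 -> 0 <= b ->
  exists V : set R,
    [set r | 0 <= r <= b /\ near_int e (w * r)] `<=` V /\
    (@lebesgue_measure R V <= ((w * b + 2) * (2 * e / w))%:E)%E.
Proof.
move=> w0 /andP[e0 e1] b0.
(* An integer within [e < 1] of a point of [[0, w b]] lies strictly between [-1] and [w b + 1]. *)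
pose m := (Num.truncn (w * b)).+2.
pose I (i : nat) : set R := `[(i%:R - e) / w, (i%:R + e) / w]%classic.
have mI i : measurable (I i) by exact: measurable_itv.
have muI i : @lebesgue_measure R (I i) = (2 * e / w)%:E.
  rewrite lebesgue_measure_itv/= lte_fin; case: ltP => [_|].
    by rewrite -EFinB; congr (_%:E); field; rewrite gt_eqF.
  rewrite ler_pM2r ?invr_gt0// => ie; have -> : e = 0 by lra.
  by rewrite mulr0 mul0r.
exists (\big[setU/set0]_(i < m) I i); split.
  move=> r [/andP[r0 rb] [z]]; rewrite ler_norml => /andP[z1 z2].
  have wr0 : 0 <= w * r by rewrite mulr_ge0// ltW.
  have wrb : w * r <= w * b by rewrite ler_pM2l.
  have : - 1 < z%:~R :> R by lra.
  rewrite -[-1]/((-1)%:~R) ltr_int.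
  case: z z1 z2 => [n|//] z1 z2 _; rewrite -[(Posz n)%:~R]/(n%:R : R) in z1 z2.
  rewrite -bigcup_mkord; exists n => /=.
    have : n%:R < (Num.truncn (w * b)).+2%:R :> R.
      by have := truncnS_gt (w * b); rewrite -[_.+2%:R]natr1; lra.
    by rewrite ltr_nat.
  by rewrite /I /= in_itv/= ler_pdivrMr// ler_pdivlMr//; apply/andP; split; lra.
apply: (@le_trans _ _ (\sum_(i < m) @lebesgue_measure R (I i))%E).
  apply: content_subadditive => //.
    by move=> k _; exact: mI.
  by apply: bigsetU_measurable => i _; exact: mI.
under eq_bigr do rewrite muI.
rewrite sumEFin lee_fin big_const_ord iter_addr_0 -[leLHS]mulr_natl ler_wpM2r//.
  by rewrite divr_ge0 ?mulr_ge0// ltW.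
have /andP[+ _] : (Num.truncn (w * b))%:R <= w * b < (Num.truncn (w * b)).+1%:R.
  by apply: trunc_itv; rewrite mulr_ge0// ltW.
by rewrite /m -[_.+2%:R]natr1 -natr1; lra.
Qed.

(** The cover has measure at most [e * (2 b + 4 / w)], and [w >= c] makes this small with [e],
    however large [w] has to be. *)
Lemma near_int_null (R : realType) (D : set R) (b c : R) : 0 <= b -> 0 < c ->
  (forall r, D r -> 0 <= r <= b) ->
  (forall e : R, 0 < e -> exists2 w, c <= w & forall r, D r -> near_int e (w * r)) ->
  @lebesgue_measure R D = 0%E.
Proof.
move=> b0 c0 Db Dw; apply: outer_null => eps eps0.
pose q := 2 * b + 4 / c.
have q0 : 0 < q by rewrite ltr_wpDl// ?mulr_ge0// divr_gt0.
pose e := Num.min 2^-1 (eps / q).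
have e0 : 0 < e by rewrite lt_min invr_gt0 ltr0n divr_gt0.
have e1 : e < 1.
  by rewrite gt_min; apply/orP; left; lra.
have eq : e * q <= eps by rewrite -ler_pdivlMr// ge_min lexx orbT.
have [w cw near] := Dw e e0.
have w0 : 0 < w by apply: lt_le_trans cw.
have [|V [DV mV]] := near_int_cover R w e b w0 _ b0; first by rewrite (ltW e0).
exists V; split; first by move=> r Dr; apply: DV; split; [exact: Db|exact: near].
apply: le_trans mV _; rewrite lee_fin; apply: le_trans eq.
have -> : (w * b + 2) * (2 * e / w) = e * (2 * b + 4 / w).
  by field; rewrite gt_eqF.
by rewrite ler_pM2l// lerD2l ler_pM2l// lef_pV2.
Qed.

(** By homogeneity [N z <= a] means that all [|u_k . z| <= a], for [a > 0]. If no [k] attained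
    [N z], a smaller [a] would do. *)
Lemma polygon_norm (R : realType) (K : nat) (N : R * R -> R) (u : 'I_K -> R * R) :
  (0 < K)%N -> is_norm2 N ->
  (forall x : R * R, N x <= 1 <->
     forall k, `|(u k).1 * x.1 + (u k).2 * x.2| <= 1) ->
  forall z, exists k, N z = `|(u k).1 * z.1 + (u k).2 * z.2|.
Proof.
move=> K0 [N0 [NZ ND]] ball z.
have scale a : 0 < a -> N z <= a <-> forall k, `|(u k).1 * z.1 + (u k).2 * z.2| <= a.
  move=> a0; have := ball (a^-1 * z.1, a^-1 * z.2); rewrite NZ /=.
  rewrite normfV (gtr0_norm a0) mulrC ler_pdivrMr// mul1r => ->.
  have E k : `|(u k).1 * (a^-1 * z.1) + (u k).2 * (a^-1 * z.2)| =
      `|(u k).1 * z.1 + (u k).2 * z.2| / a.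
    by rewrite !(mulrCA _ a^-1) -mulrDr normrM normfV (gtr0_norm a0) mulrC.
  by split=> H k; move: (H k); rewrite E ler_pdivrMr// mul1r.
have r0 : 0 <= N z.
  have := ND z (-1 * z.1, -1 * z.2); rewrite NZ normrN1 mul1r /= !mulN1r !subrr.
  by have /N0 -> : (0, 0) = (0, 0) :> R * R by []; lra.
have [r00|rn0] := eqVneq (N z) 0.
  exists (Ordinal K0); rewrite r00; move/N0 : r00 => -> /=.
  by rewrite !mulr0 addr0 normr0.
have rp : 0 < N z by rewrite lt0r rn0.
apply: contrapT => none.
have lek : forall k, `|(u k).1 * z.1 + (u k).2 * z.2| <= N z by apply/scale.
(* The base value [N z / 2] keeps [m] positive, as scaling requires, and below [N z]. *)
pose m := \big[Num.max/(N z / 2)]_k `|(u k).1 * z.1 + (u k).2 * z.2|.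
have m0 : 0 < m by apply: lt_le_trans (bigmax_ge_id _ _ _ _); rewrite divr_gt0.
have : m < N z.
  apply/bigmax_ltP; split=> [|k _]; first by lra.
  rewrite lt_neqAle lek andbT; apply/eqP => E; apply: none; by exists k.
apply/negP; rewrite -leNgt; apply/(scale m m0) => k.
exact: le_bigmax.
Qed.

Theorem theorem3 (R : realType) (K : nat) (hK : (2 <= K)%N) :
  exists A : set ('I_K -> R), lebesgue_null A /\
    forall g : 'I_K -> R, ~ A g ->
      forall N : R * R -> R, is_norm2 N ->
        unit_ball_polygon_with_slopes N g ->
        exists E : set (R * R), compact E /\
          hausdorff_dim E = 2%:E /\
          (@lebesgue_measure R) (dist_set N E) = 0%E.
Proof.
(* The set [E] is built for every [g]; boxes of volume 0 cover the empty exceptional set. *)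
exists set0; split.
  move=> eps eps0; exists (fun _ _ => 0), (fun _ _ => 0); split=> //; split=> //.
  rewrite eseries0 ?lee_fin ?ltW// => i _ _.
  by rewrite (bigD1 (Ordinal (ltnW hK)))//= subrr mul0r.
move=> g _ N hN [u [ball [_ [_ hslope]]]].
(* The index [None] adds the frequency 1, which controls [T j * x] itself. *)
pose gam (i : option 'I_K) : R := if i is Some k then g k else 1.
pose eta (j : nat) : R := j.+2%:R^-1.
have eta0 j : 0 < eta j <= 2^-1.
  by rewrite invr_gt0 ltr0n/= lef_pV2 ?posrE// ler_nat.
have [f [T [T1 f01 fT fH]]] := bohr_cantor_map R _ gam eta eta0.
pose B := closure (f @` [set t | 0 <= t < 1]).
have B01 : B `<=` `[0, 1]%classic.
  rewrite [X in _ `<=` X](closure_id _).1; last exact: itv_closed.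
  by apply: closureS => _ [t t01 <-]; rewrite /= in_itv/=; exact: f01.
(* Passing to the closure costs one more [eta j]; the [+ 1] in [q] avoids division by zero. *)
have BT j i x : B x -> near_int (3 * eta j) (gam i * T j * x).
  move=> Bx; pose q := `|gam i * T j| + 1.
  have q0 : 0 < q by rewrite ltr_wpDl.
  have d0 : 0 < eta j / q by rewrite divr_gt0//; have /andP[] := eta0 j.
  have [_ [[t t01 <-] xt]] := Bx _ (nbhsx_ballx x _ d0).
  have -> : gam i * T j * x = gam i * T j * f t + gam i * T j * (x - f t) by ring.
  have -> : 3 * eta j = 2 * eta j + eta j by ring.
  apply: near_intD; first exact: fT.
  apply: near_int_small; rewrite normrM; apply: (@le_trans _ _ (q * (eta j / q))).
    by apply: ler_pM => //; [rewrite lerDl|exact: ltW].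
  by rewrite mulrC divfK// gt_eqF.
exists (B `*` B); split; last split.
- apply: compact_setX; apply: (subclosed_compact _ (@segment_compact R 0 1)) => //;
    exact: closed_closure.
- apply: (hausdorff_dim_square f) => // t t01.
  by apply: subset_closure; exists t.
pose D (k : 'I_K) : set R := [set r | exists x y, (B `*` B) x /\ (B `*` B) y /\
  r = `|(u k).1 * (x.1 - y.1) + (u k).2 * (x.2 - y.2)|].
have D0 k : @lebesgue_measure R (D k) = 0%E.
  (* A finite slope excludes [(u k).2 = 0], so [u_k . z] is [(u k).2] times [z2 - g_k z1]. *)
  have := hslope k; rewrite /slope; case: eqVneq => // u20 [] ug.
  have uE : (u k).1 = - g k * (u k).2 by rewrite -ug; field.
  have n20 : 0 < `|(u k).2| by rewrite normr_gt0.
  apply: (near_int_null R _ (`|(u k).1| + `|(u k).2|) `|(u k).2|^-1).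
  - by rewrite addr_ge0.
  - by rewrite invr_gt0.
  - move=> _ [[x1 x2] [[y1 y2] [[/= /B01 a /B01 b] [[/= /B01 c /B01 d] ->]]]].
    rewrite /= !in_itv/= in a b c d; rewrite normr_ge0/=.
    apply: le_trans (ler_normD _ _) _; rewrite !normrM.
    by apply: lerD; rewrite -[leRHS]mulr1 ler_wpM2l// ler_norml; apply/andP; lra.
  move=> e e0; pose j := Num.truncn (12 / e).
  have je : 12 * eta j <= e.
    rewrite /eta ler_pdivrMr// mulrC -ler_pdivrMr//.
    apply/ltW; apply: lt_trans (truncnS_gt _) _; by rewrite ltr_nat.
  exists (T j / `|(u k).2|).
    by rewrite -[leLHS]mul1r ler_wpM2r// invr_ge0.
  move=> _ [[x1 x2] [[y1 y2] [[/= a b] [[/= c d] ->]]]].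
  apply: (near_int_le _ _ _ je).
  have -> : T j / `|(u k).2| * `|(u k).1 * (x1 - y1) + (u k).2 * (x2 - y2)| =
     `|T j * (x2 - y2 - g k * (x1 - y1))|.
    rewrite (normrM (T j)) (gtr0_norm (lt_le_trans ltr01 (T1 j))) -mulrA; congr (_ * _).
    have -> : (u k).1 * (x1 - y1) + (u k).2 * (x2 - y2) =
      (u k).2 * (x2 - y2 - g k * (x1 - y1)) by rewrite uE; ring.
    by rewrite normrM mulKf// gt_eqF.
  apply: near_int_norm.
  (* Four coordinates, each within [3 * eta j] of an integer after scaling, give the total
     [12 * eta j]. *)
  have -> : T j * (x2 - y2 - g k * (x1 - y1)) =
    (gam None * T j * x2 + - (gam None * T j * y2)) +
    (gam (Some k) * T j * y1 + - (gam (Some k) * T j * x1)) by rewrite /gam; ring.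
  have -> : 12 * eta j = (3 * eta j + 3 * eta j) + (3 * eta j + 3 * eta j) by ring.
  by apply: near_intD; apply: near_intD; do ?apply: near_intN; exact: BT.
(* The finite union of the [D k] is indexed by [nat], with empty sets from [K] on. *)
apply: (outer_null_bigcup R (fun n => [set r | exists2 k : 'I_K, val k = n & D k r])).
  move=> _ [x [y [Ex [Ey ->]]]].
  have [k ->] := polygon_norm R K N u (ltnW hK) hN ball (x.1 - y.1, x.2 - y.2).
  by exists (val k) => //; exists k => //; exists x, y.
move=> n; have [nK|Kn] := ltnP n K.
  rewrite -(D0 (Ordinal nK)); congr lebesgue_measure; apply/seteqP; split => r /=.
    by move=> [k kn Dr]; rewrite (_ : Ordinal nK = k)//; exact/val_inj.
  by move=> Dr; exists (Ordinal nK).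
rewrite (_ : [set r | _] = set0) ?measure0//; apply/seteqP; split => r //= [k kn _].
by move: (ltn_ord k); rewrite kn ltnNge Kn.
Qed.
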